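(* Let $n\ge1$ and let $m\ge0$ be an integer. Then \begin{align*} \mathrm{hz}_m(z_1,\ldots,z_n)&=\sum_{j=1}^n\frac{\mathcal{U}_{m+n-1}(z_j/2)}{\prod_{k\in\{1,\ldots,n\}\setminus\{j\}}(z_j-z_k)},\\ \mathrm{hz}_m(z_1,\ldots,z_n)&=\frac{1}{\prod_{1\le j<k\le n}(z_j-z_k)} \left|\begin{array}{ccc} \mathcal{U}_{m+n-1}(z_1/2)&\ldots&\mathcal{U}_{m+n-1}(z_n/2)\\ \mathcal{U}_{n-2}(z_1/2)&\ldots&\mathcal{U}_{n-2}(z_n/2)\\ \vdots&\ddots&\vdots\\ \mathcal{U}_0(z_1/2)&\ldots&\mathcal{U}_0(z_n/2) \end{array}\right|,\\ \mathrm{hz}_m(z_1,\ldots,z_n)&=\sum_{k=0}^{\lfloor m/2\rfloor}(-1)^k\binom{n+m-k-1}{k}\mathrm{h}_{m-2k}(z_1,\ldots,z_n),\\ \mathrm{hz}_m(z_1,\ldots,z_n)&=\sum_{\substack{\alpha_1,\ldots,\alpha_n\in\mathbb{N}_0\\ \alpha_1+\cdots+\alpha_n=m}}\ \prod_{j=1}^n\mathcal{U}_{\alpha_j}(z_j/2),\\ \mathrm{hz}_m(z_1,\ldots,z_n)&=\mathrm{spz}_{(m)}(z_1,\ldots,z_n),\\ \mathrm{hz}_m(z_1,\ldots,z_n)&=\sum_{k=0}^{\lfloor m/2\rfloor}\mathrm{oz}_{(m-2k)}(z_1,\ldots,z_n),\\ \mathrm{h}_m(z_1,\ldots,z_n)&=\sum_{k=0}^{\lfloor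 m/2\rfloor}\frac{(m+n-1)!\,(m+n-2k)}{k!\,(m+n-k)!}\,\mathrm{hz}_{m-2k}(z_1,\ldots,z_n). \end{align*}
   Context: $\mathbb{N}_0=\{0,1,2,\ldots\}$. $z_1,\ldots,z_n$ are independent variables; identities with denominators are in the field of rational functions in $z_1,\ldots,z_n$. $\mathcal{U}_m$ are the Chebyshev polynomials of the second kind. In the determinant, the first row has degree index $m+n-1$ and the remaining $n-1$ rows have indices $n-2,\ldots,0$. $\operatorname{Sym}_N$ is the algebra of symmetric polynomials in $N$ variables over $\mathbb{C}$. For $P\in\operatorname{Sym}_{2n}$, $\Phi_n(P)$ is the unique $Q\in\operatorname{Sym}_n$ with $P(x_1,\ldots,x_n,x_1^{-1},\ldots,x_n^{-1})=Q(x_1+x_1^{-1},\ldots,x_n+x_n^{-1})$ (existence and uniqueness hold). A superscript $(N)$ denotes restriction of a symmetric function to $N$ variables. $\mathrm{h}_m$ are the complete homogeneous symmetric functions ($\mathrm{h}_0=1$, $\mathrm{h}_k=0$ for $k<0$). For a nonempty partition $\lambda$ of length $\ell(\lambda)$, \[ \mathrm{sp}_\lambda=\tfrac12\det\bigl[\mathrm{h}_{\lambda_j-j+k}+\mathrm{h}_{\lambda_j-j-k+2}\bigr]_{j,k=1}^{\ell(\lambda)},\qquad \mathrm{o}_\lambda=\det\bigl[\mathrm{h}_{\lambda_j-j+k}-\mathrm{h}_{\lambda_j-j-k}\bigr]_{j,k=1}^{\ell(\lambda)}, \] and $\mathrm{sp}_\varnothing=\mathrm{o}_\varnothing=1$;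 the partition $(0)$ is the empty partition. Put $\mathrm{hz}_m=\Phi_n(\mathrm{h}_m^{(2n)})$, $\mathrm{spz}_\lambda=\Phi_n(\mathrm{sp}_\lambda^{(2n)})$, $\mathrm{oz}_\lambda=\Phi_n(\mathrm{o}_\lambda^{(2n)})$. *)

(* Defs.v *)
From HB Require Import structures.
From mathcomp Require Import all_boot all_order all_algebra.
From mathcomp Require Import fraction complex.
From mathcomp Require Import mpoly.
From mathcomp Require Import classical_sets reals.

Set Implicit Arguments.
Unset Strict Implicit.
Unset Printing Implicit Defensive.

Import GRing.Theory.
Local Open Scope ring_scope.

Notation "p %:F" := (@FracField.tofrac _ p) : ring_scope.

(* For [R : realType], the field [R[i]] is the field of complex numbers. *)

Definition ratfun (R : realType) (n : nat) := {fraction {mpoly R[i][n]}}.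

(* [p (f 0, f 1, ...)], with the values [f i] in the rational functions in
   [n] variables. *)
Definition meval_ratfun (R : realType) (N n : nat)
    (f : 'I_N -> ratfun R n) (p : {mpoly R[i][N]}) : ratfun R n :=
  mmap (fun c : R[i] => (c%:MP_[n])%:F) f p.

Definition ratX (R : realType) (n : nat) (i : 'I_n) : ratfun R n :=
  ('X_i : {mpoly R[i][n]})%:F.

(* x_1, ..., x_n, x_1^-1, ..., x_n^-1 *)
Definition symplectic_alphabet (R : realType) (n : nat) (i : 'I_(n + n)) :
    ratfun R n :=
  match split i with
  | inl j => ratX R j
  | inr j => (ratX R j)^-1
  end.

Definition is_Phi (R : realType) (n : nat)
    (P : {mpoly R[i][n + n]}) (Q : {mpoly R[i][n]}) : Prop :=
  Q \is symmetric /\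
  meval_ratfun (@symplectic_alphabet R n) P =
  meval_ratfun (fun j : 'I_n => ratX R j + (ratX R j)^-1) Q.

(* For symmetric [P] there is exactly one [Q] with [is_Phi P Q], and [Phi P]
   is that [Q]; the value of [Phi P] is irrelevant if [P] is not symmetric. *)
Definition Phi (R : realType) (n : nat) (P : {mpoly R[i][n + n]}) :
    {mpoly R[i][n]} :=
  xget 0 [set Q | is_Phi P Q]%classic.

(* Complete homogeneous symmetric polynomials in [N] variables; the index type
   ['X_{1..N < m.+1}] consists of the exponent vectors of degree at most [m]. *)
Definition hsym (R : realType) (N m : nat) : {mpoly R[i][N]} :=
  \sum_(a : 'X_{1..N < m.+1} | mdeg a == m) 'X_[a].

Definition hsymz (R : realType) (N : nat) (k : int) : {mpoly R[i][N]} :=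
  match k with
  | Posz m => hsym R N m
  | Negz _ => 0
  end.

(* Partitions are weakly decreasing sequences of natural numbers, up to
   trailing zeros: [[:: 0]] is the empty partition. *)
Definition partlen (la : seq nat) : nat := count (fun k => 0 < k)%N la.

(* Rows and columns are numbered from 0, hence the successors; [la`_j] is the
   part with 1-based index [j.+1]. *)
Definition sp_sym (R : realType) (N : nat) (la : seq nat) : {mpoly R[i][N]} :=
  if partlen la == 0%N then 1 else
  2^-1 *: \det (\matrix_(j < partlen la, k < partlen la)
    (hsymz R N ((nth 0%N la j)%:Z - j.+1%:Z + k.+1%:Z) +
     hsymz R N ((nth 0%N la j)%:Z - j.+1%:Z - k.+1%:Z + 2))).

Definition o_sym (R : realType) (N : nat) (la : seq nat) : {mpoly R[i][N]} :=
  if partlen la == 0%N then 1 else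
  \det (\matrix_(j < partlen la, k < partlen la)
    (hsymz R N ((nth 0%N la j)%:Z - j.+1%:Z + k.+1%:Z) -
     hsymz R N ((nth 0%N la j)%:Z - j.+1%:Z - k.+1%:Z))).

Definition hz (R : realType) (n m : nat) : {mpoly R[i][n]} :=
  Phi (hsym R (n + n) m).

Definition spz (R : realType) (n : nat) (la : seq nat) : {mpoly R[i][n]} :=
  Phi (sp_sym R (n + n) la).

Definition oz (R : realType) (n : nat) (la : seq nat) : {mpoly R[i][n]} :=
  Phi (o_sym R (n + n) la).

(* Chebyshev polynomials of the second kind: [U_0 = 1], [U_1 = 2 X],
   [U_(k+2) = 2 X U_(k+1) - U_k]. *)
Fixpoint chebU (A : nzRingType) (m : nat) : {poly A} :=
  match m with
  | 0 => 1
  | k.+1 =>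
      match k with
      | 0 => 2 *: 'X
      | l.+1 => 2 *: 'X * chebU A k - chebU A l
      end
  end.

(* U_m(z_j / 2) *)
Definition chebU_half (R : realType) (n m : nat) (j : 'I_n) : {mpoly R[i][n]} :=
  (chebU {mpoly R[i][n]} m).[2^-1 *: 'X_j].

(* Main.v *)
Require Import Defs.
From HB Require Import structures.
From mathcomp Require Import all_boot all_order all_algebra.
From mathcomp Require Import fraction complex.
From mathcomp Require Import mpoly.
From mathcomp Require Import classical_sets reals.
From mathcomp Require Import zify ring.

(** Everything follows from two generating functions in an indeterminate t,
    with [z_j = x_j + 1/x_j]:

      sum_m h_m(z_1, ..., z_n) t^m = prod_j 1 / (1 - z_j t),
      sum_m U_m(z_j / 2) t^m       = 1 / (1 - z_j t + t^2).

    Since (1 - x t)(1 - t / x) = 1 - (x + 1/x) t + t^2, the complete homogeneous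
    polynomials of the 2n variables x_j, 1/x_j have the generating function
    prod_j 1 / (1 - z_j t + t^2), which is also that of the sums of products of
    Chebyshev polynomials.  These sums are therefore a preimage for [Phi]
    ([is_Phi_hz]).  It is the only one, because the x_j + 1/x_j are
    algebraically independent ([meval_ratfun_addinv_inj]); so it is hz_m, which
    is the fourth identity.

    A power series identity F = 1 / D is expressed as [conv D f =1 delta], where
    [f] is the sequence of coefficients of F, and two sequences are identified
    by showing that the same D inverts both ([conv_inj]).

    - The two expansions between h and hz compare prod_j 1 / (1 - z_j t) with
      prod_j 1 / (1 - z_j t + t^2).  Adding one variable multiplies each series
      by one factor, and Pascal's rule for the coefficients of the expansion
      says exactly that the expansion intertwines the two factors
      ([conv_cheb_den_step2_sum], [conv_geom_den_step2_sum]).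

    - The sum over j is the partial fraction decomposition of
      prod_j 1 / (1 - z_j t + t^2) with respect to the z_j.  It comes from
      Lagrange interpolation of the constant 1, homogenized in (1 + t^2, t)
      ([lagrange_cheb_den]).

    - For the determinant, the numbers 1 / prod_(k != j) (z_j - z_k) form a
      vector orthogonal to the rows of indices n-2, ..., 0 and of pairing 1 with
      a row of index n-1.  Cramer's rule then makes the quotient of the
      determinant by the same one with first index n-1 equal to the sum over j,
      and the latter determinant is that of Vandermonde since U_i(z/2) is monic
      of degree i in z ([det_cheb]).

    - The one-row determinants are sp_(m) = h_m and o_(m) = h_m - h_(m-2), so
      the sum of the oz telescopes. *)

Set Implicit Arguments.
Unset Strict Implicit.
Unset Printing Implicit Defensive.

Import Order.TTheory GRing.Theory.
Local Open Scope ring_scope.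

(** * Convolution of a polynomial with a sequence *)
Section Series.
Variable A : comNzRingType.
Implicit Types (p q : {poly A}) (s t : nat -> A) (z : A).

(** The coefficients of the product of [p] with the power series of coefficients
    [s]. *)
Definition conv p s k := \sum_(i < k.+1) p`_i * s (k - i)%N.
Definition delta k : A := (k == 0%N)%:R.
(** The denominators of the series of the [z ^+ k] and of the values at [z / 2]
    of the Chebyshev polynomials of the second kind. *)
Definition geom_den z : {poly A} := 1 - z *: 'X.
Definition cheb_den z : {poly A} := 1 - z *: 'X + 'X^2.

(** Truncating the series at any order above [k] reduces the algebra of [conv]
    to that of polynomials. *)
Lemma coef_conv p s M k :
  (k < M)%N -> conv p s k = (p * \poly_(i < M) s i)`_k.
Proof.
move=> ltkM; rewrite coefM; apply: eq_bigr => i _.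
by rewrite coef_poly (leq_ltn_trans (leq_subr _ _) ltkM).
Qed.

Lemma eq_conv p s t : s =1 t -> conv p s =1 conv p t.
Proof. by move=> st k; apply: eq_bigr => i _; rewrite st. Qed.

Lemma convA p q s : conv (p * q) s =1 conv p (conv q s).
Proof.
move=> k; rewrite (@coef_conv _ _ k.+1)// -mulrA coefM.
by apply: eq_bigr => i _; rewrite -coef_conv// ltnS leq_subr.
Qed.

Lemma conv1 s : conv 1 s =1 s.
Proof.
by move=> k; rewrite (@coef_conv _ _ k.+1)// mul1r coef_poly ltnSn.
Qed.

Lemma conv_delta p : conv p delta =1 nth 0 p.
Proof.
move=> k; rewrite (@coef_conv _ _ k.+1)//.
rewrite (_ : \poly_(i < _) _ = 1) ?mulr1//.
apply/polyP => i; rewrite coef_poly coef1 /delta.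
by case: ltnP => // lt_ki; rewrite gtn_eqF// (leq_ltn_trans _ lt_ki).
Qed.

Lemma conv_sum (I : finType) p (F : I -> nat -> A) (c : I -> A) k :
  conv p (fun m => \sum_i c i * F i m) k = \sum_i c i * conv p (F i) k.
Proof.
rewrite /conv; under eq_bigr do rewrite mulr_sumr.
rewrite exchange_big; apply: eq_bigr => i _ /=; rewrite mulr_sumr.
by apply: eq_bigr => j _; rewrite mulrCA.
Qed.

Lemma convXn n s k :
  conv 'X^n s k = if (k < n)%N then 0 else s (k - n)%N.
Proof.
rewrite (@coef_conv _ _ k.+1)// coefXnM; case: ltnP => // _.
by rewrite coef_poly ltnS leq_subr.
Qed.

Lemma conv_geom_den z s k :
  conv (geom_den z) s k = s k - (if k is k'.+1 then z * s k' else 0).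
Proof.
rewrite (@coef_conv _ _ k.+1)// mulrBl mul1r -scalerAl coefB coefZ coefXM.
by rewrite !coef_poly ltnSn; case: k => [|k] /=; rewrite ?mulr0// (ltnW (ltnSn _)).
Qed.

Lemma conv_cheb_den z s k :
  conv (cheb_den z) s k = s k - (if k is k'.+1 then z * s k' else 0)
                      + (if k is k'.+2 then s k' else 0).
Proof.
rewrite -conv_geom_den !(@coef_conv _ _ k.+1)// [_ * _ in LHS]mulrDl coefD coefXnM.
by case: k => [|[|k]] //=; rewrite coef_poly !subSS subn0 ltnS (leq_trans (leqnSn _)).
Qed.

(** A polynomial of constant term 1 is an invertible power series. *)
Lemma conv_inj p s t : p`_0 = 1 -> conv p s =1 conv p t -> s =1 t.
Proof.
move=> p0 e k; elim/ltn_ind: k => k IH.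
have := e k; rewrite /conv !big_ord_recl /= p0 !mul1r !subn0.
under [in X in X = _]eq_bigr => i _.
  rewrite IH; last by rewrite /bump /= ltn_subrL; case: k i {IH} => [[]|].
  over.
by move/addIr.
Qed.

End Series.
Arguments delta {A}.

Section ConvMore.
Variable A : comNzRingType.

Lemma conv_geom_den_pow (z : A) : conv (geom_den z) (fun k => z ^+ k) =1 delta.
Proof.
by case=> [|k]; rewrite conv_geom_den /delta ?subr0// exprS subrr.
Qed.

Lemma geom_den_coef0 (z : A) : (geom_den z)`_0 = 1.
Proof. by rewrite coefB coefZ coefX coef1 mulr0 subr0. Qed.

Lemma cheb_den_coef0 (z : A) : (cheb_den z)`_0 = 1.
Proof. by rewrite coefD coefB coefZ coefX coefXn coef1 mulr0 subr0 addr0. Qed.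

Lemma prod_coef0 (I : finType) (p : I -> {poly A}) :
  (forall i, (p i)`_0 = 1) -> (\prod_i p i)`_0 = 1.
Proof. by move=> p0; rewrite coef0_prod big1. Qed.

Lemma rmorph_conv (B : comNzRingType) (f : {rmorphism A -> B}) p s k :
  f (conv p s k) = conv (map_poly f p) (f \o s) k.
Proof.
by rewrite rmorph_sum; apply: eq_bigr => i _; rewrite rmorphM coef_map.
Qed.

Lemma map_cheb_den (B : comNzRingType) (f : {rmorphism A -> B}) z :
  map_poly f (cheb_den z) = cheb_den (f z).
Proof.
rewrite /cheb_den -!mul_polyC rmorphD rmorphB rmorph1 rmorphM /= map_polyC.
by rewrite map_polyX map_polyXn.
Qed.

End ConvMore.

(** The reason why the variables [x + x^-1] turn the geometric series in [x] and
    [x^-1] into one Chebyshev series. *)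
Lemma geom_den_mul_inv (K : fieldType) (x : K) : x != 0 ->
  geom_den x * geom_den x^-1 = cheb_den (x + x^-1).
Proof.
move=> x0; rewrite /geom_den /cheb_den mulrBl mul1r mulrBr mulr1 -scalerAl -scalerAr.
by rewrite scalerA divff// scale1r scalerDl -expr2; ring.
Qed.

(** * Products of power series, one for each variable *)
Section MultiConv.
Variable A : comNzRingType.
Variable n : nat.
Implicit Types (u : 'I_n -> nat -> A).

(** The coefficient of degree [m] in the product of the series [u j]. *)
Definition multiconv u m :=
  \sum_(a : 'X_{1..n < m.+1} | mdeg a == m) \prod_(j < n) u j (a j).

Lemma coef_multiconv u M m :
  (m < M)%N -> multiconv u m = (\prod_j \poly_(k < M) u j k)`_m.
Proof.
case: M => // M ltmM.
under eq_bigr do rewrite poly_def.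
rewrite bigA_distr_bigA coef_sum /=.
transitivity (\sum_(f : {ffun 'I_n -> 'I_M.+1} | (\sum_j f j)%N == m)
   \prod_j u j (f j)); last first.
  rewrite big_mkcond; apply: eq_bigr => f _.
  rewrite scaler_prod -expr_sum coefZ coefXn eq_sym.
  by case: eqP => _; rewrite ?mulr1 ?mulr0.
have sumE (f : 'I_n -> nat) : mdeg [multinom f j | j < n] = (\sum_j f j)%N.
  by rewrite mdegE; apply: eq_bigr => j _; rewrite mnmE.
pose F (a : 'X_{1..n < m.+1}) : {ffun 'I_n -> 'I_M.+1} :=
  [ffun j => inord (a j)].
pose G (f : {ffun 'I_n -> 'I_M.+1}) : 'X_{1..n < m.+1} :=
  insubd bm0 [multinom (f j : nat) | j < n].
have GE (f : {ffun 'I_n -> 'I_M.+1}) j : (\sum_j f j)%N == m -> G f j = f j.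
  by move/eqP=> fm; rewrite /G insubdK ?mnmE// /in_mem /= sumE fm ltnSn.
have FE (a : 'X_{1..n < m.+1}) j : mdeg a == m -> F a j = a j :> nat.
  move=> am; rewrite ffunE inordK//.
  have : (a j <= mdeg a)%N by rewrite mdegE (bigD1 j)//= leq_addr.
  by rewrite (eqP am) => /leq_ltn_trans; apply.
(* [F] and [G] are mutually inverse between the exponent vectors of degree [m]
   and the maps to ['I_M.+1] of sum [m]; the default [bm0] is never reached. *)
rewrite (reindex_omap F (fun f => Some (G f))) /=; last first.
  move=> f fm; congr Some; apply/ffunP => j.
  by apply/val_inj; rewrite /= ffunE GE// inord_val.
apply: eq_big => [a|a /[dup] am /FE aE]; last first.
  by apply: eq_bigr => j _; rewrite aE.
apply/idP/andP => [am|[/eqP Fm /eqP[Ga]]].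
  have sm : (\sum_j F a j)%N == m.
    by under eq_bigr do rewrite FE//; rewrite -mdegE.
  split=> //; apply/eqP; congr Some; apply/val_inj/mnmP => j /=.
  by rewrite GE// FE.
rewrite -Ga {1}/G insubdK ?sumE ?Fm//.
by rewrite /in_mem /= sumE Fm.
Qed.

(** The inverse of a product is the product of the inverses: modulo the power
    [k.+1] of the indeterminate, each factor [p j * u j] is 1. *)
Lemma conv_multiconv (p : 'I_n -> {poly A}) u :
  (forall j, conv (p j) (u j) =1 delta) ->
  conv (\prod_j p j) (multiconv u) =1 delta.
Proof.
move=> pu k.
transitivity ((\prod_j (p j * \poly_(i < k.+1) u j i))`_k).
  rewrite big_split /= coefM; apply: eq_bigr => i _.
  by rewrite (@coef_multiconv _ k.+1)// ltnS leq_subr.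
suff /(_ k (leqnn k)) : forall i, (i <= k)%N ->
  (\prod_j (p j * \poly_(i < k.+1) u j i))`_i = delta i by [].
elim/big_ind: _ => [i _|q r qE rE i lik|j _ i lik].
- by rewrite coef1.
- rewrite coefM big_ord_recl /= qE// mul1r subn0 rE// big1 ?addr0// => j _.
  by rewrite /bump qE ?mul0r//= (leq_trans _ lik) ?ltn_ord.
- by rewrite -coef_conv ?pu// ltnS.
Qed.

End MultiConv.

Lemma rmorph_multiconv (A B : comNzRingType) (f : {rmorphism A -> B}) n
    (u : 'I_n -> nat -> A) m :
  f (multiconv u m) = multiconv (fun j k => f (u j k)) m.
Proof.
by rewrite rmorph_sum; apply: eq_bigr => a _; rewrite rmorph_prod.
Qed.

(** * Expansions in steps of two and Pascal's rule *)
Section Step2Sum.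
Variable A : comNzRingType.
Implicit Types (c : nat -> nat -> A) (s : nat -> A) (z : A).

(** The common shape of the expansions of hz in h and of h in hz, for [n]
    variables. *)
Definition step2_sum c n s m :=
  \sum_(0 <= k < (m %/ 2).+1) c (n + m)%N k * s (m - 2 * k)%N.

Lemma eq_step2_sum c n s t : s =1 t -> step2_sum c n s =1 step2_sum c n t.
Proof. by move=> st m; apply: eq_bigr => k _; rewrite st. Qed.

Lemma step2_sum0 c n s : step2_sum c n s 0 = c n 0%N * s 0%N.
Proof. by rewrite /step2_sum divn_small// big_nat1 addn0. Qed.

Lemma step2_sum1 c n s : step2_sum c n s 1 = c n.+1 0%N * s 1%N.
Proof. by rewrite /step2_sum divn_small// big_nat1 addn1. Qed.

Lemma step2_sumSS c n s m : step2_sum c n s m.+2 =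
  c (n + m).+2 0%N * s m.+2 +
  \sum_(0 <= k < (m %/ 2).+1) c (n + m).+2 k.+1 * s (m - 2 * k)%N.
Proof.
rewrite /step2_sum (_ : m.+2 %/ 2 = (m %/ 2).+1)%N; last lia.
rewrite big_nat_recl// !addnS muln0 subn0; congr (_ + _).
by apply: eq_bigr => k _; rewrite mulnS.
Qed.

(** When [m] is even, the two ranges coincide; when [m] is odd, the left one has
    the additional index [(m + 1) / 2], where the second factor is 0. *)
Lemma sum_half_pred (F s : nat -> A) m :
  \sum_(0 <= k < (m.+1 %/ 2).+1)
     F k * (if (m.+1 - 2 * k)%N is k'.+1 then s k' else 0)
  = \sum_(0 <= k < (m %/ 2).+1) F k * s (m - 2 * k)%N.
Proof.
rewrite [RHS](big_nat_widen _ _ (m.+1 %/ 2).+1); last lia.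
rewrite [RHS]big_mkcond; apply: eq_big_nat => k lek.
case: ltnP => km; last first.
  by rewrite (_ : m.+1 - 2 * k = 0)%N ?mulr0//; lia.
by rewrite subSn//; lia.
Qed.

(** Without variables both h and hz are [delta], which starts the inductions on
    the number of variables. *)
Lemma step2_sum_delta c :
  c 0%N 0%N = 1 -> (forall k, c (2 * k.+1)%N k.+1 = 0) ->
  step2_sum c 0 delta =1 delta.
Proof.
move=> c0 cS [|m]; first by rewrite step2_sum0 mulr1.
apply: big1_seq => k /andP[_]; rewrite mem_index_iota => lek.
rewrite /delta; case: eqP => [e|_]; last by rewrite mulr0.
case: k e lek => [|k] e lek; first lia.
have -> : (0 + m.+1 = 2 * k.+1)%N by lia.
by rewrite cS mul0r.
Qed.

(** The coefficients of [U_(N-1)(z / 2)], hence the case of one variable. *)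
Definition cheb_coef N k : A := (-1) ^+ k * 'C(N - k - 1, k)%:R.

Lemma cheb_coef0 N : cheb_coef N 0 = 1.
Proof. by rewrite /cheb_coef bin0 mulr1. Qed.

Lemma cheb_coefSS N k : (k.+1 < N)%N ->
  cheb_coef N.+1 k.+1 = cheb_coef N k.+1 - cheb_coef N.-1 k.
Proof.
move=> kN; rewrite /cheb_coef.
have -> : (N.+1 - k.+1 - 1 = (N - k.+1 - 1).+1)%N by lia.
have -> : (N.-1 - k - 1 = N - k.+1 - 1)%N by lia.
by rewrite binS natrD exprS; ring.
Qed.

(** Ballot numbers, as a difference of two binomial coefficients; this form
    makes Pascal's rule immediate, [factorial_ballot] gives the closed form. *)
Definition ballot N k : A :=
  'C(N.-1, k)%:R - (if k is k'.+1 then 'C(N.-1, k')%:R else 0).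

Lemma ballot0 N : ballot N 0 = 1.
Proof. by rewrite /ballot bin0 subr0. Qed.

Lemma ballotSS N k : (0 < N)%N ->
  ballot N.+1 k.+1 = ballot N k.+1 + ballot N k.
Proof.
case: N => // N _; rewrite /ballot /= binS natrD.
by case: k => [|k]; rewrite ?binS ?bin0 ?natrD; ring.
Qed.

(** The expansion intertwines the removal of one variable from h, through the
    factor [geom_den z], with its removal from hz, through [cheb_den z].  The
    terms in [z] agree on both sides and the others agree by [cheb_coefSS]. *)
Lemma conv_cheb_den_step2_sum n s z :
  conv (cheb_den z) (step2_sum cheb_coef n.+1 s) =1
  step2_sum cheb_coef n (conv (geom_den z) s).
Proof.
case=> [|[|m]]; rewrite conv_cheb_den.
- by rewrite !step2_sum0 !cheb_coef0 !mul1r conv_geom_den; ring.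
- by rewrite !step2_sum1 step2_sum0 !cheb_coef0 !mul1r conv_geom_den; ring.
rewrite [in RHS]/step2_sum; under [RHS]eq_bigr do rewrite conv_geom_den mulrBr.
rewrite sumrB.
have -> : \sum_(0 <= k < (m.+2 %/ 2).+1) cheb_coef (n + m.+2) k *
     (if (m.+2 - 2 * k)%N is k'.+1 then z * s k' else 0)
   = z * step2_sum cheb_coef n.+1 s m.+1.
  rewrite (sum_half_pred (cheb_coef (n + m.+2)) (fun k => z * s k)).
  rewrite mulr_sumr; apply: eq_bigr => k _.
  by rewrite addSn addnS; ring.
rewrite addrAC; congr (_ - _).
rewrite -/(step2_sum cheb_coef n s m.+2) !step2_sumSS !cheb_coef0 -!addrA; congr (_ + _).
rewrite -big_split /=; apply: eq_big_nat => k lek.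
rewrite addSn cheb_coefSS; last lia.
by rewrite /=; ring.
Qed.

(** The same for the inverse expansion, with [ballotSS] for the terms without
    [z]. *)
Lemma conv_geom_den_step2_sum n s z :
  conv (geom_den z) (step2_sum ballot n.+1 s) =1
  step2_sum ballot n (conv (cheb_den z) s).
Proof.
case=> [|[|m]]; rewrite conv_geom_den.
- by rewrite !step2_sum0 !ballot0 !mul1r conv_cheb_den; ring.
- by rewrite !step2_sum1 step2_sum0 !ballot0 !mul1r conv_cheb_den; ring.
rewrite [in RHS]/step2_sum; under [RHS]eq_bigr do rewrite conv_cheb_den mulrDr mulrBr.
rewrite big_split sumrB /=.
have -> : \sum_(0 <= k < (m.+2 %/ 2).+1) ballot (n + m.+2) k *
     (if (m.+2 - 2 * k)%N is k'.+1 then z * s k' else 0)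
   = z * step2_sum ballot n.+1 s m.+1.
  rewrite (sum_half_pred (ballot (n + m.+2)) (fun k => z * s k)).
  rewrite mulr_sumr; apply: eq_bigr => k _.
  by rewrite addSn addnS; ring.
rewrite addrAC; congr (_ - _).
have -> : \sum_(0 <= k < (m.+2 %/ 2).+1) ballot (n + m.+2) k *
     (if (m.+2 - 2 * k)%N is k'.+2 then s k' else 0)
   = \sum_(0 <= k < (m %/ 2).+1) ballot (n + m.+2) k * s (m - 2 * k)%N.
  rewrite -sum_half_pred.
  rewrite -(sum_half_pred _ (fun k => if k is k'.+1 then s k' else 0)).
  by apply: eq_bigr => k _; case: (m.+2 - 2 * k)%N.
rewrite -/(step2_sum ballot n s m.+2) !step2_sumSS !ballot0 -!addrA; congr (_ + _).
rewrite -big_split /=; apply: eq_big_nat => k lek.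
rewrite addSn ballotSS; last lia.
by rewrite !addnS; ring.
Qed.

(** Removing the variables one at a time leads to the case without variables,
    where the middle coefficient 'C(i, i + 1) vanishes. *)
Lemma conv_prod_cheb_den_step2_sum n (z : 'I_n -> A) s :
  conv (\prod_j geom_den (z j)) s =1 delta ->
  conv (\prod_j cheb_den (z j)) (step2_sum cheb_coef n s) =1 delta.
Proof.
elim: n z s => [|n IH] z s e k; rewrite ?big_ord0 ?big_ord_recr.
  rewrite conv1 (eq_step2_sum _ _ (t := delta)); last first.
    by move=> i; rewrite -e big_ord0 conv1.
  rewrite step2_sum_delta ?cheb_coef0// => i; rewrite /cheb_coef bin_small ?mulr0//.
  lia.
rewrite convA (eq_conv _ (conv_cheb_den_step2_sum _ _ _)) IH// => i.
by rewrite -convA -e big_ord_recr.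
Qed.

(** Here the case without variables holds by the symmetry of the binomial
    coefficients: 'C(2 i + 1, i + 1) = 'C(2 i + 1, i). *)
Lemma conv_prod_geom_den_step2_sum n (z : 'I_n -> A) s :
  conv (\prod_j cheb_den (z j)) s =1 delta ->
  conv (\prod_j geom_den (z j)) (step2_sum ballot n s) =1 delta.
Proof.
elim: n z s => [|n IH] z s e k; rewrite ?big_ord0 ?big_ord_recr.
  rewrite conv1 (eq_step2_sum _ _ (t := delta)); last first.
    by move=> i; rewrite -e big_ord0 conv1.
  rewrite step2_sum_delta ?ballot0// => i; rewrite /ballot.
  rewrite -(@bin_sub (2 * i.+1).-1 i) ?subrr//; last lia.
  by rewrite (_ : (2 * i.+1).-1 - i = i.+1)%N ?subrr//; lia.
rewrite convA (eq_conv _ (conv_geom_den_step2_sum _ _ _)) IH// => i.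
by rewrite -convA -e big_ord_recr.
Qed.

End Step2Sum.
Arguments cheb_coef {A}.
Arguments ballot {A}.

Lemma factorial_ballot (K : numFieldType) n m k :
  (0 < n)%N -> (2 * k <= m)%N ->
  ballot (n + m) k =
    ((m + n - 1)`! * (m + n - 2 * k))%:R / (k`! * (m + n - k)`!)%:R :> K.
Proof.
move=> n0 km; rewrite addnC.
have [N NE] : {N | m + n = N.+1}%N by exists (m + n).-1; lia.
rewrite NE subn1 /=.
have D0 : (k`! * (N.+1 - k)`!)%:R != 0 :> K.
  by rewrite Num.Theory.pnatr_eq0 -lt0n muln_gt0 !fact_gt0.
apply: (canRL (mulfK D0)).
case: k km D0 => [|k] km _.
  by rewrite ballot0 mul1r fact0 mul1n muln0 !subn0 mulnC factS.
rewrite /ballot /= mulrBl -!natrM subSS.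
have kN : (k.+1 <= N)%N by lia.
have e1 := bin_fact kN.
have e2 := bin_fact (ltnW kN).
have e3 : (N - k = (N - k.+1).+1)%N by lia.
rewrite (_ : ('C(N, k) * (k.+1`! * (N - k)`!) = N`! * k.+1)%N); last first.
  by rewrite -e2 [in LHS]factS; lia.
rewrite (_ : ('C(N, k.+1) * (k.+1`! * (N - k)`!) = N`! * (N - k))%N); last first.
  by rewrite -e1 e3 [(_.+1)`! in X in (_ * (_ * X))%N]factS; lia.
by rewrite -natrB ?leq_mul2l; [rewrite -mulnBr; congr (_ * _)%:R | ]; lia.
Qed.

(** * Uniqueness of the preimage defining [Phi] *)
Lemma mpolyU_neq0 (K : fieldType) n (j : 'I_n) : ('X_j : {mpoly K[n]}) != 0.
Proof. by rewrite -msupp_eq0 msuppX. Qed.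

Section LeadingMonomial.
Variables (K : fieldType) (n : nat).

(** The monomial of exponent [b] in the [x_j + 1/x_j], multiplied by the [d]-th
    power of all the variables to make it a polynomial. *)
Definition clear_denom d (b : 'X_{1..n}) : {mpoly K[n]} :=
  \prod_j ('X_j ^+ (d - b j) * ('X_j ^+ 2 + 1) ^+ b j).

Lemma mlead_sqrX_add1 (j : 'I_n) :
  mlead ('X_j ^+ 2 + 1 : {mpoly K[n]}) = (U_(j) *+ 2)%MM.
Proof.
rewrite mpolyXn mleadDl mleadXm// mlead1 lt_neqAle.
rewrite le0x andbT; apply/eqP => /mnmP/(_ j).
by rewrite mulmnE mnm1E eqxx mnm0E.
Qed.

Lemma sqrX_add1_neq0 (j : 'I_n) : ('X_j ^+ 2 + 1 : {mpoly K[n]}) != 0.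
Proof.
apply/eqP => /(congr1 (@mlead _ _)); rewrite mlead_sqrX_add1 mlead0.
by move/mnmP/(_ j); rewrite mulmnE mnm1E eqxx mnm0E.
Qed.

Lemma mleadc_sqrX_add1 (j : 'I_n) : mleadc ('X_j ^+ 2 + 1 : {mpoly K[n]}) = 1.
Proof.
rewrite mlead_sqrX_add1 mpolyXn mcoeffD mcoeffX eqxx mcoeff1.
case: eqP => [/mnmP/(_ j)|]; last by rewrite addr0.
by rewrite mulmnE mnm1E eqxx mnm0E.
Qed.

Lemma lreg_clear (j : 'I_n) e f :
  GRing.lreg (mleadc ('X_j ^+ e * ('X_j ^+ 2 + 1) ^+ f : {mpoly K[n]})).
Proof.
by apply/lregP; rewrite mleadc_eq0 mulf_neq0 ?expf_neq0 ?sqrX_add1_neq0 ?mpolyU_neq0.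
Qed.

(** Clearing the denominators shifts all exponents by the same vector, so
    distinct exponents [b] give distinct leading monomials, in the same order. *)
Lemma mlead_clear_denom d (b : 'X_{1..n}) : (forall j, b j <= d)%N ->
  mlead (clear_denom d b) = ([multinom d | _ < n] + b)%MM.
Proof.
move=> bd; rewrite /clear_denom mlead_prod_proper => [|j _ _]; last exact: lreg_clear.
apply/mnmP => i; rewrite mnm_sumE mnmDE mnmE (bigD1 i)//= big1 => [|j ji].
  rewrite mleadM ?expf_neq0 ?sqrX_add1_neq0 ?mpolyU_neq0//.
  rewrite !mleadX ?sqrX_add1_neq0 ?mpolyU_neq0// mleadXm mlead_sqrX_add1.
  rewrite mnmDE !mulmnE mnm1E eqxx; have := bd i; lia.
rewrite mleadM ?expf_neq0 ?sqrX_add1_neq0 ?mpolyU_neq0//.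
rewrite !mleadX ?sqrX_add1_neq0 ?mpolyU_neq0// mleadXm mlead_sqrX_add1.
by rewrite mnmDE !mulmnE mnm1E (negPf ji).
Qed.

Lemma mleadc_clear_denom d (b : 'X_{1..n}) :
  mleadc (clear_denom d b) = 1.
Proof.
rewrite /clear_denom mleadc_prod_proper => [|j _ _]; last exact: lreg_clear.
apply: big1 => j _.
rewrite mleadcM_proper.
  rewrite !mleadcX_proper ?mleadc_sqrX_add1 ?expr1n ?mulr1 ?mleadXm ?mcoeffX ?eqxx ?expr1n//;
  exact: lreg1.
by rewrite mulf_neq0 ?mleadc_eq0 ?expf_neq0 ?sqrX_add1_neq0 ?mpolyU_neq0.
Qed.

(** Only the leading monomial of [Q] contributes to the leading coefficient of
    the sum. *)
Lemma sum_clear_denom_eq0 d (Q : {mpoly K[n]}) :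
  (forall b, b \in msupp Q -> forall j, b j <= d)%N ->
  \sum_(b <- msupp Q) Q@_b *: clear_denom d b = 0 -> Q = 0.
Proof.
move=> Qd e; apply/eqP; rewrite -mleadc_eq0; apply/negP => /negP Q0.
have /(congr1 (mcoeff ([multinom d | _ < n] + mlead Q)%MM)) := e.
have Qa : mlead Q \in msupp Q by rewrite mcoeff_msupp.
rewrite mcoeff0 raddf_sum /= (bigD1_seq (mlead Q)) ?msupp_uniq//=.
rewrite big1_seq => [|b /andP[bQ bs]]; last first.
  rewrite mcoeffZ (mcoeff_gt_mlead (p := clear_denom d b)) ?mulr0//.
  rewrite mlead_clear_denom; last exact: Qd.
  by rewrite ltmc_add2r lt_neqAle bQ msupp_le_mlead.
rewrite addr0 mcoeffZ -mlead_clear_denom; last exact: Qd.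
by rewrite mleadc_clear_denom mulr1; apply/eqP.
Qed.

End LeadingMonomial.

Section PhiUniqueness.
Variables (R : realType).

Lemma ratX_neq0 n (j : 'I_n) : ratX R j != 0.
Proof. by rewrite tofrac_eq0 mpolyU_neq0. Qed.

Lemma ratX_inj n : injective (@ratX R n).
Proof.
move=> i j /eqP; rewrite tofrac_eq => /eqP/(congr1 (mcoeff U_(i)%MM)).
rewrite !mcoeffX eqxx; case: eqP => [/mnmP/(_ i)|_ /eqP]; last by rewrite oner_eq0.
by rewrite !mnm1E eqxx; case: eqP => // ->.
Qed.

Definition ratC n : {rmorphism R[i] -> ratfun R n} :=
  GRing.RMorphism.clone _ _ (@FracField.tofrac {mpoly R[i][n]} \o @mpolyC n R[i]) _.

(** [meval_ratfun], bundled as a ring morphism. *)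
Definition meval_morph N n (f : 'I_N -> ratfun R n) :
    {rmorphism {mpoly R[i][N]} -> ratfun R n} :=
  GRing.RMorphism.clone _ _ (mmap (ratC n) f) _.

Lemma meval_morphE N n (f : 'I_N -> ratfun R n) p :
  meval_ratfun f p = meval_morph f p.
Proof. by []. Qed.

Lemma meval_morphX N n (f : 'I_N -> ratfun R n) j : meval_morph f 'X_j = f j.
Proof. by rewrite /= mmapX mmap1U. Qed.

(** The [x_j + 1/x_j] are algebraically independent: a relation between them
    becomes, without denominators, one between the [clear_denom d b]. *)
Lemma meval_ratfun_addinv_inj n (P Q : {mpoly R[i][n]}) :
  meval_ratfun (fun j => ratX R j + (ratX R j)^-1) P =
  meval_ratfun (fun j => ratX R j + (ratX R j)^-1) Q -> P = Q.
Proof.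
move=> /eqP; rewrite -subr_eq0 !meval_morphE -rmorphB => /eqP e.
apply/eqP; rewrite -subr_eq0; apply/eqP; move: (P - Q) e => {P Q}Q e.
(* Any bound on the exponents of [Q] serves to clear the denominators. *)
pose d := msize Q.
have Qd b : b \in msupp Q -> forall j, (b j <= d)%N.
  move=> bs j; have := msize_mdeg_lt bs; rewrite mdegE (bigD1 j)//= -/d; lia.
apply: (sum_clear_denom_eq0 Qd); apply/eqP; rewrite -tofrac_eq0; apply/eqP.
have : meval_morph (fun j => ratX R j + (ratX R j)^-1) Q *
   \prod_j ratX R j ^+ d = 0 by rewrite e mul0r.
rewrite /= /mmap mulr_suml rmorph_sum => {2}<-.
rewrite big_seq [RHS]big_seq; apply: eq_bigr => b bs.
rewrite -mul_mpolyC rmorphM -mulrA; congr (_ * _).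
rewrite /mmap1 -big_split rmorph_prod; apply: eq_bigr => j _ /=.
rewrite rmorphM !rmorphXn rmorphD rmorphXn rmorph1 -/(ratX R j).
rewrite -{2}(subnK (Qd b bs j)) exprD mulrCA; congr (_ * _).
rewrite -exprMn; congr (_ ^+ _).
by rewrite mulrDl mulVf ?ratX_neq0// expr2.
Qed.

Lemma Phi_unique n (P : {mpoly R[i][n + n]}) Q : is_Phi P Q -> Phi P = Q.
Proof.
move=> PQ; apply: xget_unique => //= Q' [_ e].
by apply: meval_ratfun_addinv_inj; rewrite -e PQ.2.
Qed.

End PhiUniqueness.

(** * The polynomials hz and their expansions *)
Section CompleteHomogeneousZ.
Variable R : realType.

Lemma hsymE n m : hsym R n m = multiconv (fun j k => 'X_j ^+ k) m.
Proof. by apply: eq_bigr => a _; rewrite mpolyXE_id. Qed.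

Lemma conv_hsym n : conv (\prod_j geom_den 'X_j) (hsym R n) =1 delta.
Proof.
by move=> k; rewrite (eq_conv _ (hsymE n)) conv_multiconv// => j; apply: conv_geom_den_pow.
Qed.

Lemma mcoeff_hsym n m a : (hsym R n m)@_a = (mdeg a == m)%:R.
Proof.
rewrite raddf_sum /=; under eq_bigr do rewrite mcoeffX.
have [am|am] := eqVneq (mdeg a) m; last first.
  rewrite big1// => b /eqP bm; case: eqP => // ba.
  by rewrite -ba bm eqxx in am.
have am' : (mdeg a < m.+1)%N by rewrite am.
rewrite (bigD1 (BMultinom am'))/= ?am// eqxx big1 ?addr0// => b /andP[_ ba].
by case: eqP => // e; case/eqP: ba; apply/val_inj.
Qed.

Lemma hsym_sym n m : hsym R n m \is symmetric.
Proof.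
by apply/issymP => s; apply/mpolyP => a; rewrite mcoeff_sym !mcoeff_hsym mdeg_mperm.
Qed.

Lemma hsym0 n : hsym R n 0 = 1.
Proof. by apply/mpolyP => a; rewrite mcoeff_hsym mcoeff1 mdeg_eq0. Qed.

Lemma conv_chebU_half n (j : 'I_n) :
  conv (cheb_den 'X_j) (fun k => chebU_half R k j) =1 delta.
Proof.
have two : (2 : {mpoly R[i][n]}) * (2^-1 *: 'X_j) = 'X_j.
  rewrite -[2]/(2%:R) mulr_natl -scaler_nat scalerA divff ?scale1r//.
  by rewrite Num.Theory.pnatr_eq0.
case=> [|[|k]]; rewrite conv_cheb_den /chebU_half /delta /= ?hornerE.
- by rewrite subr0.
- by rewrite two subrr.
- by rewrite two; ring.
Qed.

(** The explicit value of hz, in terms of Chebyshev polynomials. *)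
Definition hz_cheb n m := multiconv (fun j k => @chebU_half R n k j) m.

Lemma conv_hz_cheb n : conv (\prod_j cheb_den 'X_j) (hz_cheb n) =1 delta.
Proof. by apply: conv_multiconv => j; apply: conv_chebU_half. Qed.

(** Both sides are inverted by the product of the [cheb_den 'X_j]. *)
Lemma hz_cheb_step2_sum n : hz_cheb n =1 step2_sum cheb_coef n (hsym R n).
Proof.
apply: (@conv_inj _ (\prod_j cheb_den 'X_j)).
  by apply: prod_coef0 => j; rewrite cheb_den_coef0.
by move=> k; rewrite conv_hz_cheb (conv_prod_cheb_den_step2_sum (@conv_hsym n)).
Qed.

Lemma hsym_step2_sum n : hsym R n =1 step2_sum ballot n (hz_cheb n).
Proof.
apply: (@conv_inj _ (\prod_j geom_den 'X_j)).
  by apply: prod_coef0 => j; rewrite geom_den_coef0.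
by move=> k; rewrite conv_hsym (conv_prod_geom_den_step2_sum (@conv_hz_cheb n)).
Qed.

Lemma cheb_coefE n N k (p : {mpoly R[i][n]}) :
  cheb_coef N k * p = ((-1) ^+ k * 'C(N - k - 1, k)%:R) *: p.
Proof. by rewrite -mul_mpolyC rmorphM rmorph_sign rmorph_nat. Qed.

Lemma ballotE n N k (p : {mpoly R[i][n]}) :
  ballot N k * p = ballot N k *: p.
Proof.
rewrite -mul_mpolyC /ballot rmorphB rmorph_nat.
by case: k => [|k]; rewrite ?rmorph_nat ?rmorph0.
Qed.

(** The symmetry is read off the expansion in the [hsym], whose coefficients
    depend only on the degree. *)
Lemma hz_cheb_sym n m : hz_cheb n m \is symmetric.
Proof.
rewrite hz_cheb_step2_sum rpred_sum// => k _.
by rewrite cheb_coefE rpredZ// hsym_sym.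
Qed.

(** In the rational functions, the product of the denominators [geom_den] at
    the [x_j] and [1/x_j] is that of the [cheb_den] at the [x_j + 1/x_j]; it
    inverts both evaluations. *)
Lemma is_Phi_hz n m : is_Phi (hsym R (n + n) m) (hz_cheb n m).
Proof.
split; first exact: hz_cheb_sym.
rewrite !meval_morphE hsymE !rmorph_multiconv; move: m.
pose D := \prod_j cheb_den (ratX R (n := n) j + (ratX R j)^-1).
apply: (@conv_inj _ D) => [|m].
  by apply: prod_coef0 => j; rewrite cheb_den_coef0.
rewrite [RHS]conv_multiconv => [|j k]; last first.
  pose f := meval_morph (fun j : 'I_n => ratX R j + (ratX R j)^-1).
  have := congr1 f (conv_chebU_half j k).
  by rewrite rmorph_conv map_cheb_den meval_morphX rmorph_nat.
have -> : D = \prod_i geom_den (@symplectic_alphabet R n i).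
  rewrite big_split_ord /= -big_split; apply: eq_bigr => j _ /=.
  rewrite /symplectic_alphabet.
  by rewrite (unsplitK (inl j)) (unsplitK (inr j)) geom_den_mul_inv// ratX_neq0.
apply: conv_multiconv => i k; rewrite -(conv_geom_den_pow (symplectic_alphabet R i) k).
by apply: eq_conv => e; rewrite rmorphXn meval_morphX.
Qed.

Lemma hzE n m : hz R n m = hz_cheb n m.
Proof. exact/Phi_unique/is_Phi_hz. Qed.

Lemma sp_sym_row N m : sp_sym R N [:: m] = hsym R N m.
Proof.
rewrite /sp_sym; case: m => [|m]; first by rewrite hsym0.
rewrite /= det_mx11 mxE /=.
rewrite (_ : m.+1 - 1 + 1 = m.+1)%N; last lia.
rewrite (_ : m.+1%:Z - 1%:Z - 1%:Z + 2 = m.+1); last lia.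
rewrite /= -mulr2n -scalerMnr scalerMnl -mulr_natr mulVf ?scale1r//.
by rewrite Num.Theory.pnatr_eq0.
Qed.

Lemma o_sym_row N m : o_sym R N [:: m] =
  hsym R N m - (if m is k.+2 then hsym R N k else 0).
Proof.
rewrite /o_sym; case: m => [|m]; first by rewrite hsym0 subr0.
rewrite /= det_mx11 mxE /=.
rewrite (_ : m.+1 - 1 + 1 = m.+1)%N; last lia.
by case: m => [|m]; [|rewrite (_ : m.+2%:Z - 1%:Z - 1%:Z = m); last lia].
Qed.

(** Since o_(m) = h_m - h_(m-2), a difference of preimages is the preimage. *)
Lemma ozE n m : oz R n [:: m] =
  hz_cheb n m - (if m is k.+2 then hz_cheb n k else 0).
Proof.
apply: Phi_unique; rewrite o_sym_row.
case: m => [|[|m]]; rewrite ?subr0; try exact: is_Phi_hz.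
have [s e] := is_Phi_hz n m.+2; have [s' e'] := is_Phi_hz n m.
split; first by apply: rpredB; [exact: s | exact: s'].
rewrite !meval_morphE in e e' *.
by rewrite !rmorphB; congr (_ - _); [exact: e | exact: e'].
Qed.

Lemma sum_oz n m :
  \sum_(0 <= k < (m %/ 2).+1) oz R n [:: (m - 2 * k)%N] = hz_cheb n m.
Proof.
elim/ltn_ind: m => -[|[|m]] IH; try by rewrite divn_small// big_nat1 ozE subr0.
rewrite (_ : m.+2 %/ 2 = (m %/ 2).+1)%N; last lia.
rewrite big_nat_recl// muln0 subn0 ozE.
under eq_bigr do rewrite mulnS.
by rewrite IH// subrK.
Qed.

End CompleteHomogeneousZ.

(** * Determinants *)
Section Determinants.
Variable A : comNzRingType.

(** The matrix of the coefficients of the [p i] is unitriangular. *)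
Lemma det_monic_Vandermonde n (p : 'I_n -> {poly A}) (a : 'I_n -> A) :
  (forall i, (size (p i) <= i.+1)%N) -> (forall i : 'I_n, (p i)`_i = 1) ->
  \det (\matrix_(i < n, j < n) (p i).[a j]) =
  \prod_(i < n) \prod_(j < n | (i < j)%N) (a j - a i).
Proof.
move=> sz mon.
transitivity (\det ((\matrix_(i < n, k < n) (p i)`_k) *m
                    Vandermonde n (\row_j a j))).
  congr (\det _); apply/matrixP => i j; rewrite !mxE.
  rewrite (horner_coef_wide _ (leq_trans (sz i) (ltn_ord i))).
  by apply: eq_bigr => k _; rewrite !mxE.
rewrite det_mulmx det_trig; last first.
  apply/is_trig_mxP => i j ij; rewrite mxE nth_default//.
  exact: leq_trans (sz i) ij.
rewrite big1 ?mul1r => [|i _]; last by rewrite mxE mon.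
rewrite det_Vandermonde; apply: eq_bigr => i _; apply: eq_bigr => j _.
by rewrite !mxE.
Qed.

Lemma det_rev n (B : 'M[A]_n) :
  \det (\matrix_(i < n, j < n) B (rev_ord i) (rev_ord j)) = \det B.
Proof.
pose s := perm.perm (@rev_ord_inj n).
transitivity (\det (row_perm s (col_perm s B))).
  by congr (\det _); apply/matrixP => i j; rewrite !mxE !perm.permE.
rewrite row_permE col_permE !det_mulmx !det_perm perm.odd_permV mulrCA.
by rewrite -expr2 sqrr_sign mulr1.
Qed.

(** With the degrees in decreasing order, reversing rows and columns together
    leaves the determinant unchanged and replaces each difference by its
    opposite. *)
Lemma det_monic_Vandermonde_rev n (p : nat -> {poly A}) (a : 'I_n -> A) :
  (forall i, (size (p i) <= i.+1)%N) -> (forall i, (p i)`_i = 1) ->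
  \det (\matrix_(i < n, j < n) (p (rev_ord i)).[a j]) =
  \prod_(j < n) \prod_(k < n | (j < k)%N) (a j - a k).
Proof.
move=> sz mon; rewrite -det_rev.
under eq_mx do rewrite mxE rev_ordK.
rewrite (@det_monic_Vandermonde n (fun i => p i) (fun j => a (rev_ord j)))//.
under eq_bigr => i _ do rewrite (reindex_inj rev_ord_inj).
rewrite (reindex_inj rev_ord_inj) /=.
under eq_bigr => i _ do under eq_bigr => j _ do rewrite !rev_ordK.
rewrite (exchange_big_dep predT)//=; apply: eq_bigr => j _.
by apply: eq_bigl => i /=; have := ltn_ord i; have := ltn_ord j; lia.
Qed.

End Determinants.

(** * Partial fractions and the determinant formula *)
Section DividedDifferences.
Variable K : fieldType.

(** Cramer's rule for the system of unknown [w]: the cofactors of the first row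
    do not depend on that row. *)
Lemma det_row0_dual n (F : 'I_n.+1 -> 'I_n.+1 -> K) (w v : 'I_n.+1 -> K) :
  w ord0 != 0 ->
  (forall i, \sum_j F i j * w j = (i == ord0)%:R) ->
  \det (\matrix_(i, j) if i == ord0 then v j else F i j) =
  (\sum_j v j * w j) * \det (\matrix_(i, j) F i j).
Proof.
move=> w0 Fw.
pose M u := \matrix_(i, j) if i == ord0 then u j else F i j.
have Mw u : M u *m (\col_j w j) = (\sum_j u j * w j) *: delta_mx ord0 ord0.
  apply/matrixP => i k; rewrite !mxE ord1 eqxx andbT.
  under eq_bigr do rewrite !mxE.
  by case: eqP => [_|/eqP/negPf i0]; rewrite ?mulr1// mulr0 Fw i0.
have detM u : \det (M u) * w ord0 = (\sum_j u j * w j) * cofactor (M u) ord0 ord0.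
  have /(congr1 (fun C : 'cV_n.+1 => C ord0 ord0)) := congr1 (mulmx (\adj (M u))) (Mw u).
  rewrite mulmxA mul_adj_mx mul_scalar_mx -scalemxAr !mxE => ->; congr (_ * _).
  rewrite (bigD1 ord0)//= big1 ?addr0 ?mxE ?mulr1// => j /negPf j0.
  by rewrite !mxE j0 mulr0.
have cofM u u' : cofactor (M u) ord0 ord0 = cofactor (M u') ord0 ord0.
  by congr (_ * \det _); apply/matrixP => i j; rewrite !mxE.
have -> : \matrix_(i, j) F i j = M (F ord0).
  by apply/matrixP => i j; rewrite !mxE; case: eqP => [->|].
apply: (mulIf w0); rewrite -mulrA !detM (cofM v (F ord0)).
by rewrite Fw eqxx mul1r.
Qed.

Variables (n : nat) (z : 'I_n.+1 -> K).
Hypothesis z_inj : injective z.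

Definition diffprod j := \prod_(k < n.+1 | k != j) (z j - z k).

Lemma diffprod_neq0 j : diffprod j != 0.
Proof.
apply/prodf_neq0 => k kj; rewrite subr_eq0 eq_sym.
by apply: contra kj => /eqP/z_inj ->.
Qed.

(** Lagrange interpolation of the constant 1 at the [z j]: the difference has
    degree at most [n] and [n.+1] roots. *)
Lemma lagrange_one :
  \sum_j (diffprod j)^-1 *: \prod_(k < n.+1 | k != j) ('X - (z k)%:P) = 1.
Proof.
apply/eqP; rewrite -subr_eq0; apply/eqP.
apply: (@roots_geq_poly_eq0 _ _ (codom z)).
- apply/allP => _ /codomP[i ->]; rewrite /root hornerD hornerN hornerC horner_sum.
  rewrite (bigD1 i)//= [X in _ + X - _]big1 ?addr0 => [|j ji]; last first.
    rewrite hornerZ horner_prod (bigD1 i) 1?eq_sym//=.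
    by rewrite hornerXsubC subrr mul0r mulr0.
  rewrite hornerZ horner_prod.
  under eq_bigr do rewrite hornerXsubC.
  by rewrite mulVf ?subrr// diffprod_neq0.
- by rewrite map_inj_uniq ?enum_uniq.
rewrite size_codom card_ord; apply: (leq_trans (size_polyD _ _)).
rewrite size_polyN size_poly1 geq_max andbT.
apply: (leq_trans (size_sum _ _ _)); apply/bigmax_leqP => j _.
apply: (leq_trans (size_scale_leq _ _)).
rewrite (eq_bigl (mem (predC1 j)))// -big_enum size_prod_XsubC -cardE.
by rewrite cardC1 card_ord.
Qed.

Lemma lagrange_one_morph (L : comNzRingType) (f : {rmorphism K -> L}) y :
  \sum_j f (diffprod j)^-1 * \prod_(k < n.+1 | k != j) (y - f (z k)) = 1.
Proof.
have := congr1 (fun p => (map_poly f p).[y]) lagrange_one.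
rewrite rmorph1 hornerC rmorph_sum horner_sum => e; rewrite -[RHS]e; apply: eq_bigr => j _ /=.
rewrite -[_ *: _]mul_polyC rmorphM /= map_polyC hornerM hornerC; congr (_ * _).
rewrite rmorph_prod horner_prod; apply: eq_bigr => k _ /=.
by rewrite map_polyXsubC hornerXsubC.
Qed.

(** Interpolation evaluated at [(1 + X^2) / X = X + X^-1], times [X^n]. *)
Lemma lagrange_cheb_den :
  \sum_j (diffprod j)^-1 *: \prod_(k < n.+1 | k != j) cheb_den (z k) = 'X^n.
Proof.
have factor (L : fieldType) (u a : L) :
  u != 0 -> 1 - a * u + u ^+ 2 = (u + u^-1 - a) * u.
  by move=> u0; field.
pose f : {rmorphism K -> {fraction {poly K}}} :=
  GRing.RMorphism.clone _ _ (@FracField.tofrac {poly K} \o polyC) _.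
pose x := ('X : {poly K})%:F.
have x0 : x != 0 by rewrite tofrac_eq0 polyX_eq0.
apply/eqP; rewrite -tofrac_eq tofracXn -/x -[x ^+ n]mul1r; apply/eqP.
rewrite -(lagrange_one_morph f (x + x^-1)) mulr_suml rmorph_sum.
apply: eq_bigr => j _; rewrite -mul_polyC rmorphM -mulrA; congr (_ * _).
have -> : x ^+ n = \prod_(k < n.+1 | k != j) x.
  by rewrite prodr_const cardC1 card_ord.
rewrite rmorph_prod -big_split; apply: eq_bigr => k _ /=.
rewrite /cheb_den -mul_polyC !(rmorphD, rmorphN, rmorphM, rmorphXn, rmorph1) /= -/x.
exact: factor.
Qed.

Variables (c : 'I_n.+1 -> nat -> K) (g : nat -> K).
Hypothesis cE : forall j, conv (cheb_den (z j)) (c j) =1 delta.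
Hypothesis gE : conv (\prod_j cheb_den (z j)) g =1 delta.

(** Multiplying by all the [cheb_den (z k)] cancels the [j]-th factor against
    [c j] and leaves the left-hand side of [lagrange_cheb_den].  For [r < n] the
    sum is 0, and for [r = n] it is 1: this gives the dual vector needed for the
    determinant. *)
Lemma sum_cheb_diffprod r :
  \sum_j c j r * (diffprod j)^-1 = conv 'X^n g r.
Proof.
under eq_bigr do rewrite mulrC.
move: r; apply: (@conv_inj _ (\prod_j cheb_den (z j))) => [|r].
  by apply: prod_coef0 => j; rewrite cheb_den_coef0.
rewrite conv_sum -convA mulrC convA (eq_conv _ gE) conv_delta -lagrange_cheb_den.
rewrite coef_sum; apply: eq_bigr => j _.
rewrite coefZ; congr (_ * _).
by rewrite (bigD1 j)//= mulrC convA (eq_conv _ (@cE j)) conv_delta.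
Qed.

Lemma sum_cheb_diffprod_shift m : \sum_j c j (m + n)%N * (diffprod j)^-1 = g m.
Proof. by rewrite sum_cheb_diffprod convXn ltnNge leq_addl /= addnK. Qed.

(** The monic polynomials U_i(X / 2), as the expansion for the single variable
    ['X]. *)
Definition chebmon : nat -> {poly K} := step2_sum cheb_coef 1 (fun k => 'X^k).

Lemma conv_chebmon : conv (cheb_den 'X) chebmon =1 delta.
Proof.
move=> k; have := @conv_prod_cheb_den_step2_sum _ 1 (fun=> 'X : {poly K}) (fun k => 'X^k).
by rewrite !big_ord1 => -> // i; apply: conv_geom_den_pow.
Qed.

(** Monic of degree [i]: by the recurrence of order two. *)
Lemma coef_chebmon i l : (i <= l)%N -> (chebmon i)`_l = (i == l)%:R.
Proof.
elim/ltn_ind: i l => i IH l il.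
have := conv_chebmon i; rewrite conv_cheb_den /delta.
case: i IH il => [|i] IH il.
  by rewrite subr0 addr0 => ->; rewrite coef1 eq_sym.
case: l il => // l il /eqP.
have -> : (if i is k'.+1 then chebmon k' else 0) = chebmon i.-1 *+ (0 < i).
  by case: i {IH il}.
rewrite -addrA addr_eq0 opprD opprK => /eqP ->.
rewrite coefB coefXM /= IH// coefMn eqSS.
case: i IH il => [|i] IH il; first by rewrite mulr0n subr0.
rewrite IH//=; last by rewrite !ltnS in il; exact: leqW (ltnW il).
have -> : (i == l.+1) = false by apply/ltn_eqF; exact: ltnW il.
by rewrite mul0rn subr0.
Qed.

Lemma horner_chebmon j i : (chebmon i).[z j] = c j i.
Proof.
move: i; apply: (@conv_inj _ (cheb_den (z j))) => [|k]; first exact: cheb_den_coef0.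
have := congr1 (horner_eval (z j)) (conv_chebmon k).
rewrite rmorph_conv map_cheb_den /= /horner_eval hornerX cE.
by rewrite /delta => ->; rewrite hornerMn hornerC.
Qed.

Lemma det_cheb m :
  \det (\matrix_(i < n.+1, j < n.+1)
          c j (if i == 0%N :> nat then m + n else n - i)%N) =
  g m * \prod_(j < n.+1) \prod_(k < n.+1 | (j < k)%N) (z j - z k).
Proof.
(* The Vandermonde determinant is that of the rows of indices [n], ..., 0, which
   differs from the given matrix by its first row only. *)
rewrite -(@det_monic_Vandermonde_rev _ _ chebmon).
- rewrite -sum_cheb_diffprod_shift -det_row0_dual ?invr_neq0 ?diffprod_neq0//.
    congr (\det _); apply/matrixP => i j; rewrite !mxE -val_eqE /=.
    by case: ifP => // _; rewrite horner_chebmon subSS.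
  move=> i; under eq_bigr do rewrite horner_chebmon.
  rewrite sum_cheb_diffprod convXn /= subSS -val_eqE /=.
  have [i0|i0] := eqVneq (i : nat) 0%N.
    rewrite i0 subn0 ltnn subnn.
    have := gE 0%N; rewrite /conv big_ord1 /= prod_coef0 ?mul1r// => j.
    exact: cheb_den_coef0.
  by rewrite ifT//; have := ltn_ord i; lia.
- move=> i; apply/leq_sizeP => l il.
  by rewrite coef_chebmon ?(ltn_eqF il)// ltnW.
- by move=> i; rewrite coef_chebmon ?eqxx.
Qed.

End DividedDifferences.

Theorem theorem1p5 (R : realType) (n m : nat) (hn : (1 <= n)%N) :
  (hz R n m)%:F =
    \sum_(j < n) (chebU_half R (m + n - 1) j)%:F /
                 \prod_(k < n | k != j) (ratX R j - ratX R k)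
  /\
  (hz R n m)%:F =
    1 / (\prod_(j < n) \prod_(k < n | (j < k)%N) (ratX R j - ratX R k)) *
    \det (\matrix_(i < n, j < n)
      (chebU_half R (if i == 0%N :> nat then m + n - 1 else n - 1 - i)%N j)%:F)
  /\
  hz R n m =
    \sum_(0 <= k < (m %/ 2).+1)
      ((-1) ^+ k * 'C(n + m - k - 1, k)%:R) *: hsym R n (m - 2 * k)
  /\
  hz R n m =
    \sum_(a : 'X_{1..n < m.+1} | mdeg a == m)
      \prod_(j < n) chebU_half R (a j) j
  /\
  hz R n m = spz R n [:: m]
  /\
  hz R n m = \sum_(0 <= k < (m %/ 2).+1) oz R n [:: (m - 2 * k)%N]
  /\
  hsym R n m =
    \sum_(0 <= k < (m %/ 2).+1)
      (((m + n - 1)`! * (m + n - 2 * k))%:R / (k`! * (m + n - k)`!)%:R)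
        *: hz R n (m - 2 * k).
Proof.
case: n hn => // n _.
have [m1 n1] : (m + n.+1 - 1 = m + n)%N /\ (n.+1 - 1 = n)%N by lia.
have cE (j : 'I_n.+1) :
    conv (cheb_den (ratX R j)) (fun k => (chebU_half R k j)%:F) =1 delta.
  move=> k; have := congr1 (@FracField.tofrac _) (conv_chebU_half R j k).
  by rewrite rmorph_conv map_cheb_den rmorph_nat.
have gE : conv (\prod_j cheb_den (ratX R j))
    (fun k => (hz_cheb R n.+1 k)%:F) =1 delta.
  move=> k; have := congr1 (@FracField.tofrac _) (conv_hz_cheb R n.+1 k).
  rewrite rmorph_conv rmorph_prod rmorph_nat /delta => <-.
  by under eq_bigr do rewrite -map_cheb_den.
have z_inj := @ratX_inj R n.+1.
rewrite !hzE.
refine (conj _ (conj _ (conj _ (conj _ (conj _ (conj _ _)))))).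
- by rewrite m1 -(sum_cheb_diffprod_shift z_inj cE gE).
- rewrite m1 n1 (det_cheb z_inj cE gE) mulrCA div1r mulVf ?mulr1//.
  apply/prodf_neq0 => j _; apply/prodf_neq0 => k jk.
  by rewrite subr_eq0; apply: contraTneq jk => /z_inj ->; rewrite ltnn.
- rewrite hz_cheb_step2_sum; apply: eq_bigr => k _; exact: cheb_coefE.
- by [].
- by rewrite /spz sp_sym_row -/(hz R n.+1 m) hzE.
- by rewrite sum_oz.
- rewrite hsym_step2_sum; apply: eq_big_nat => k lek.
  rewrite hzE ballotE factorial_ballot//; lia.
Qed.
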